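(* Let $\Phi=(A;\{E_i\}_{i=0}^d;A^*;\{E^*_i\}_{i=0}^d)$ be a tridiagonal system on $V$ with $d\ge 1$, dual eigenvalue sequence $\{\theta^*_i\}_{i=0}^d$, and let $R,F,L$ be the $\Phi$-raising, $\Phi$-flat and $\Phi$-lowering maps. Let $\beta,\gamma,\gamma^*,\varrho,\varrho^*\in\mathbb F$ be scalars satisfying the tridiagonal relations, and let $\theta^*_{-1},\theta^*_{d+1}$ be the extended scalars (see context). Then: (i) For $2\le i\le d$ the equation $$g^-_i FL^2+LFL+g^+_i L^2F=\gamma L^2$$ holds on $E^*_iV$ and the equation $$g^-_i R^2F+RFR+g^+_i FR^2=\gamma R^2$$ holds on $E^*_{i-2}V$, where $$g^+_i=\frac{\theta^*_i-\theta^*_{i+1}}{\theta^*_i-\theta^*_{i-2}},\qquad g^-_i=\frac{\theta^*_{i-2}-\theta^*_{i-3}}{\theta^*_{i-2}-\theta^*_i}.$$ (ii) For $1\le i\le d$ the equation $$e^-_i RL^2+(\beta+2)LRL+e^+_i L^2R+LF^2-\beta FLF+F^2L=\gamma(LF+FL)+\varrho L$$ holds on $E^*_iV$ and the equation $$e^-_i R^2L+(\beta+2)RLR+e^+_i LR^2+F^2R-\beta FRF+RF^2=\gamma(FR+RF)+\varrho R$$ holds on $E^*_{i-1}V$, where $$e^+_i=\frac{\theta^*_i-\theta^*_{i+2}}{\theta^*_i-\theta^*_{i-1}}\quad(1\le i\le d-1),\qquad e^-_i=\frac{\theta^*_{i-1}-\theta^*_{i-3}}{\theta^*_{i-1}-\theta^*_i}\quad(2\le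 i\le d),$$ and $e^+_d$, $e^-_1$ are indeterminates (i.e. they may be taken to be arbitrary scalars). (iii) For $0\le i\le d$ the equation $$(\theta^*_i-\theta^*_{i+1})[F,LR]=(\theta^*_{i-1}-\theta^*_i)[F,RL]$$ holds on $E^*_iV$.
   Context: Let $\mathbb F$ be a field and $V$ a nonzero finite-dimensional vector space over $\mathbb F$; $\mathrm{End}(V)$ is the algebra of $\mathbb F$-linear maps $V\to V$, with identity $I$; $[X,Y]=XY-YX$. A tridiagonal pair on $V$ is an ordered pair $A,A^*\in\mathrm{End}(V)$ such that: (1) each of $A,A^*$ is diagonalizable; (2) there is an ordering $\{V_i\}_{i=0}^d$ of the eigenspaces of $A$ with $A^*V_i\subseteq V_{i-1}+V_i+V_{i+1}$ $(0\le i\le d)$, where $V_{-1}=V_{d+1}=0$; (3) there is an ordering $\{V^*_i\}_{i=0}^\delta$ of the eigenspaces of $A^*$ with $AV^*_i\subseteq V^*_{i-1}+V^*_i+V^*_{i+1}$ $(0\le i\le\delta)$, where $V^*_{-1}=V^*_{\delta+1}=0$; (4) there is no subspace $W\subseteq V$ with $W\ne0$, $W\ne V$, $AW\subseteq W$, $A^*W\subseteq W$. It is known that $d=\delta$. Orderings as in (2), (3) are called standard. For a diagonalizable map, the primitive idempotent attached to an eigenspace is the projection onto that eigenspace that vanishes on the other eigenspaces; an ordering of primitive idempotents is standard if the corresponding ordering of eigenspaces is. A tridiagonal system on $V$ is a sequence $\Phi=(A;\{E_i\}_{i=0}^d;A^*;\{E^*_i\}_{i=0}^d)$ where $A,A^*$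 is a tridiagonal pair on $V$, $\{E_i\}$ is a standard ordering of the primitive idempotents of $A$, and $\{E^*_i\}$ is a standard ordering of the primitive idempotents of $A^*$. Let $\theta_i$ (resp. $\theta^*_i$) be the eigenvalue of $A$ (resp. $A^*$) for $E_i$ (resp. $E^*_i$); $\{\theta_i\}_{i=0}^d$ and $\{\theta^*_i\}_{i=0}^d$ are the eigenvalue and dual eigenvalue sequences. Throughout $d\ge1$. Define $R=\sum_{i=0}^{d-1}E^*_{i+1}AE^*_i$, $F=\sum_{i=0}^dE^*_iAE^*_i$, $L=\sum_{i=1}^dE^*_{i-1}AE^*_i$ (the $\Phi$-raising, $\Phi$-flat, $\Phi$-lowering maps). Tridiagonal relations: there exist scalars $\beta,\gamma,\gamma^*,\varrho,\varrho^*\in\mathbb F$ (fixed throughout) such that $0=[A,A^2A^*-\beta AA^*A+A^*A^2-\gamma(AA^*+A^*A)-\varrho A^*]$ and $0=[A^*,A^{*2}A-\beta A^*AA^*+AA^{*2}-\gamma^*(A^*A+AA^* )-\varrho^*A]$. It is known that then $\gamma^*=\theta^*_{i-1}-\beta\theta^*_i+\theta^*_{i+1}$ for $1\le i\le d-1$. The scalars $\theta^*_{-1}$ and $\theta^*_{d+1}$ are defined so that this equation also holds at $i=0$ and $i=d$, i.e. $\theta^*_{-1}=\gamma^*+\beta\theta^*_0-\theta^*_1$ and $\theta^*_{d+1}=\gamma^*+\beta\theta^*_d-\theta^*_{d-1}$. *)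

(* Defs.v *)
From mathcomp Require Import all_boot all_order all_algebra.
Set Implicit Arguments.
Unset Strict Implicit.
Unset Printing Implicit Defensive.
Import GRing.Theory.
Local Open Scope ring_scope.

(* Composition in 'End(V): (X ** Y) v = X (Y v).  The ring structure that
   falgebra puts on 'End(V) multiplies in the opposite order. *)
Notation "X ** Y" := (comp_lfun X Y) (at level 40, left associativity)
  : ring_scope.

Section TDSystem.
Variables (F : fieldType) (V : vectType F).
Implicit Types (A B As X Y E : 'End(V)) (W : {vspace V}).

Definition lfcomm X Y : 'End(V) := X ** Y - Y ** X.

Definition leigenspace A (a : F) : {vspace V} := lker (A - a *: \1%VF).

Definition leigenvalue A (a : F) : bool := leigenspace A a != 0%VS.

Definition lfun_diagonalizable A : Prop :=
  exists b : seq V,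
    basis_of {:V} b /\ {in b, forall v, exists a : F, A v = a *: v}.

Definition eigenspace_ordering A d (U : 'I_d.+1 -> {vspace V}) : Prop :=
  injective U /\
  forall W, (exists i, W = U i)
            <-> (exists2 a : F, leigenvalue A a & W = leigenspace A a).

(* The sum ranges over the j in {i - 1, i, i + 1} that lie in {0, ..., d}. *)
Definition standard_ordering A B d (U : 'I_d.+1 -> {vspace V}) : Prop :=
  eigenspace_ordering A U /\
  forall i : 'I_d.+1,
    (B @: U i <= \sum_(j < d.+1 | (j <= i.+1)%N && (i <= j.+1)%N) U j)%VS.

Definition td_pair A As : Prop :=
  [/\ lfun_diagonalizable A /\ lfun_diagonalizable As,
      exists d, exists U : 'I_d.+1 -> {vspace V}, standard_ordering A As U,
      exists d, exists U : 'I_d.+1 -> {vspace V}, standard_ordering As A U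
    & ~ exists W, [/\ W != 0%VS, W != {:V}%VS,
                      (A @: W <= W)%VS & (As @: W <= W)%VS]].

(* E is the primitive idempotent of the diagonalizable map A attached to the
   eigenspace W. *)
Definition primitive_idempotent A W E : Prop :=
  {in W, forall v, E v = v} /\
  forall a : F, leigenspace A a != W ->
    {in leigenspace A a, forall v, E v = 0}.

Definition standard_idempotents A B d (E : 'I_d.+1 -> 'End(V)) : Prop :=
  exists2 U : 'I_d.+1 -> {vspace V},
    standard_ordering A B U & forall i, primitive_idempotent A (U i) (E i).

Definition td_system d A (E : 'I_d.+1 -> 'End(V))
    As (Es : 'I_d.+1 -> 'End(V)) : Prop :=
  [/\ td_pair A As, standard_idempotents A As E
    & standard_idempotents As A Es].

Definition eigenvalue_sequence d A (E : 'I_d.+1 -> 'End(V))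
    (th : 'I_d.+1 -> F) : Prop :=
  forall i, leigenvalue A (th i) /\ limg (E i) = leigenspace A (th i).

Definition raising d A (Es : 'I_d.+1 -> 'End(V)) : 'End(V) :=
  \sum_(0 <= i < d) Es (inord i.+1) ** A ** Es (inord i).

Definition flat d A (Es : 'I_d.+1 -> 'End(V)) : 'End(V) :=
  \sum_(0 <= i < d.+1) Es (inord i) ** A ** Es (inord i).

Definition lowering d A (Es : 'I_d.+1 -> 'End(V)) : 'End(V) :=
  \sum_(1 <= i < d.+1) Es (inord i.-1) ** A ** Es (inord i).

Definition tridiagonal_relations A As (beta gamma gammas rho rhos : F) : Prop :=
  0 = lfcomm A (A ** A ** As - beta *: (A ** As ** A) + As ** A ** A
                - gamma *: (A ** As + As ** A) - rho *: As) /\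
  0 = lfcomm As (As ** As ** A - beta *: (As ** A ** As) + A ** As ** As
                 - gammas *: (As ** A + A ** As) - rhos *: A).

End TDSystem.

Section ExtendedEigenvalues.
Variables (F : fieldType) (d : nat).

(* Only the values at k = -1, 0, ..., d + 1 are meaningful (for d >= 1). *)
Definition extend_dual_eigenvalues (ths : 'I_d.+1 -> F) (beta gammas : F)
    (k : int) : F :=
  match k with
  | Posz n => if (n <= d)%N then ths (inord n)
              else gammas + beta * ths (inord d) - ths (inord d.-1)
  | Negz _ => gammas + beta * ths (inord 0) - ths (inord 1)
  end.

Variable th : int -> F.

Definition g_plus (i : int) : F := (th i - th (i + 1)) / (th i - th (i - 2)).

Definition g_minus (i : int) : F :=
  (th (i - 2) - th (i - 3)) / (th (i - 2) - th i).

(* x is the arbitrary value taken by the indeterminate e^+_d *)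
Definition e_plus (x : F) (i : int) : F :=
  if i == d :> int then x else (th i - th (i + 2)) / (th i - th (i - 1)).

(* y is the arbitrary value taken by the indeterminate e^-_1 *)
Definition e_minus (y : F) (i : int) : F :=
  if i == 1 then y else (th (i - 1) - th (i - 3)) / (th (i - 1) - th i).

End ExtendedEigenvalues.

(* Main.v *)
(* Grade V by the eigenspaces of A*, so that A = L + F + R with L, F, R of
   degrees -1, 0, 1.  The component of degree e of the first tridiagonal relation,
   applied to the i-th eigenspace of A*, is a combination of words in L, F, R
   whose coefficients involve the theta*; with the recurrence
   theta*_{j-1} - beta theta*_j + theta*_{j+1} = gamma*, which follows from the
   second relation and irreducibility, the components of degree -2, 2 give (i)
   and those of degree -1, 1 give (ii).  The component of degree 0 is (iii)
   multiplied by beta + 1.  If beta = -1, the theta* have period 3, hence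
   d <= 2, and then A satisfies a relation of the same shape with beta = 0. *)

Require Import Defs.
From mathcomp Require Import all_boot all_order all_algebra.
From mathcomp Require Import zify ring.
Set Implicit Arguments.
Unset Strict Implicit.
Unset Printing Implicit Defensive.
Import GRing.Theory.
Local Open Scope ring_scope.

Local Notation leigenspace := Defs.leigenspace.
Local Notation leigenvalue := Defs.leigenvalue.

(** * Linearity of endomorphisms *)

Section LfunLinear.
Variables (K : fieldType) (V : vectType K) (f : 'End(V)).

(* Used instead of linearD, linearN, linearZ, which also match the addition
   and scaling operators as linear maps and loop. *)
Lemma lfunD u v : f (u + v) = f u + f v. Proof. exact: linearD. Qed.
Lemma lfunN u : f (- u) = - f u. Proof. exact: linearN. Qed.
Lemma lfunZ a u : f (a *: u) = a *: f u. Proof. exact: linearZ. Qed.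
Lemma lfun0 : f 0 = 0. Proof. exact: linear0. Qed.
Lemma lfun_sum I (r : seq I) (P : pred I) (g : I -> V) :
  f (\sum_(i <- r | P i) g i) = \sum_(i <- r | P i) f (g i).
Proof. exact: linear_sum. Qed.

End LfunLinear.

(** * Spectral decomposition, and the tridiagonal relations read block by block *)

Section Spectral.
Variables (K : fieldType) (V : vectType K) (d : nat).
Implicit Types (A B X : 'End(V)) (E : 'I_d.+1 -> 'End(V)) (th : 'I_d.+1 -> K).

Lemma mem_leigenspace A a v : (v \in leigenspace A a) = (A v == a *: v).
Proof.
by rewrite memv_ker !lfun_simp /= subr_eq0.
Qed.

Lemma leigenspace_inj A a b :
  leigenvalue A a -> leigenspace A a = leigenspace A b -> a = b.
Proof.
move=> nz eqU; have := memv_pick (leigenspace A a).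
set v := vpick _ => va; have vb := va; rewrite eqU in vb.
move: va vb; rewrite !mem_leigenspace => /eqP-> /eqP /eqP.
rewrite -subr_eq0 -scalerBl scaler_eq0 subr_eq0 vpick0 => /orP[/eqP //|].
by rewrite (negPf nz).
Qed.

Definition spectral_family A E th : Prop :=
  [/\ injective th,
      forall v, \sum_i E i v = v,
      forall i v, A (E i v) = th i *: E i v,
      forall i v, E i (A v) = th i *: E i v
    & forall (i j : 'I_d.+1) v, E i (E j v) = if i == j then E i v else 0].

(** Every vector of an eigenbasis lies in some [U j], so two linear maps that agree on all [U j] are
    equal ([extU]). Each spectral identity is therefore checked only on eigenvectors, where [E i] is
    the identity or zero. *)
Lemma standard_idempotents_spectral A B E :
    lfun_diagonalizable A -> standard_idempotents A B E ->
  exists th, [/\ spectral_family A E th,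
    forall i, leigenvalue A (th i) /\ limg (E i) = leigenspace A (th i)
  & forall (i j : 'I_d.+1) v, ~~ ((i <= j.+1)%N && (j <= i.+1)%N) -> E i (B (E j v)) = 0].
Proof.
move=> [b [b_basis b_eig]] [U [[Uinj UP] UB] EP].
have /fin_all_exists2[th thE UE] : forall i, exists2 a, leigenvalue A a
    & U i = leigenspace A a.
  by move=> i; apply/(UP (U i)); exists i.
have memU i v : (v \in U i) = (A v == th i *: v).
  by rewrite UE mem_leigenspace.
have EU i j v : v \in U j -> E i v = if i == j then v else 0.
  case: eqP => [<-|/eqP neq] vU; first by apply: (EP i).1.
  have U_neq : leigenspace A (th j) != U i.
    by rewrite -UE; apply: contraNneq neq => /Uinj->.
  by apply: ((EP i).2 (th j)) => //; rewrite -UE.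
have extU (X Y : 'End(V)) : (forall j v, v \in U j -> X v = Y v) -> forall v, X v = Y v.
  move=> XY v; have : v \in <<in_tuple b>>%VS by rewrite (span_basis b_basis) memvf.
  move/coord_span=> ->; rewrite !linear_sum /=; apply: eq_bigr => k _.
  rewrite !linearZ /=; congr (_ *: _).
  set w := _`_k; have wb : w \in b by apply: mem_nth; exact: ltn_ord.
  have [a Awa] := b_eig w wb.
  have w0 : w != 0 by apply: free_not0 wb; case/andP: b_basis.
  have wa : w \in leigenspace A a by rewrite mem_leigenspace Awa.
  have ea : leigenvalue A a.
    by apply: contraNneq w0 => eq0; move: wa; rewrite eq0 memv0.
  have [j Uj] : exists j, leigenspace A a = U j by apply/UP; exists a.
  by apply: (XY j); rewrite -Uj.
have EmemU i v : E i v \in U i.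
  (* Membership in [U i] is turned into the linear identity A E_i = θ_i E_i, to which [extU]
     applies. *)
  rewrite memU; apply/eqP.
  have := extU (A \o E i)%VF (th i *: E i); rewrite /eqfun => /(_ _ v).
  rewrite !lfun_simp; apply => j w wU; rewrite !lfun_simp /= (EU i j) //.
  case: eqP => [eij|_]; last by rewrite linear0 scaler0.
  by apply/eqP; rewrite -memU eij.
exists th; split; last 1 first.
- move=> i j v nij; have : B (E j v) \in (B @: U j)%VS by apply: memv_img.
  move/(subvP (UB j)) => /memv_sumP[w wU ->].
  rewrite linear_sum big1 //= => k /andP[kj jk].
  rewrite (EU i k); last by apply: wU; rewrite kj jk.
  by case: eqP => // ik; rewrite ik kj jk in nij.
- split.
  + move=> i j eq_th; apply: Uinj; rewrite !UE eq_th //.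
  + move=> v; have := extU (\sum_i E i) \1%VF => /(_ _ v).
    rewrite sum_lfunE id_lfunE; apply => j w wU.
    rewrite sum_lfunE id_lfunE (bigD1 j) //= (EU j j) // eqxx.
    by rewrite big1 ?addr0 // => k kj; rewrite (EU k j) // (negPf kj).
  + by move=> i v; apply/eqP; rewrite -memU.
  + move=> i v; have := extU (E i \o A)%VF (th i *: E i) => /(_ _ v).
    rewrite !lfun_simp; apply => j w wU; rewrite !lfun_simp /=.
    have /eqP-> : A w == th j *: w by rewrite -memU.
    rewrite linearZ /= (EU i j) //.
    by case: eqP => [->//|_]; rewrite !scaler0.
  + move=> i j v; rewrite (EU i j) //.
    case: eqP => [->//|//].
- move=> i; split=> //; rewrite -UE; apply/eqP; rewrite eqEsubv.
  apply/andP; split; apply/subvP => v.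
  + by case/memv_imgP => w _ ->.
  + by move=> vU; rewrite -[v](_ : E i v = v) ?memv_img ?memvf // (EU i i) // eqxx.
Qed.

(** The symmetric polynomial by which the bracket of a tridiagonal relation multiplies the (a, b)
    block of [B]. The outer commutator contributes the further factor a - b in [td_expr_block]. *)
Definition td_poly (beta gamma rho a b : K) : K :=
  a ^+ 2 - beta * a * b + b ^+ 2 - gamma * (a + b) - rho.

Definition td_expr A B beta gamma rho : 'End(V) :=
  lfcomm A (A ** A ** B - beta *: (A ** B ** A) + B ** A ** A
            - gamma *: (A ** B + B ** A) - rho *: B).

Lemma td_expr_block A B E th beta gamma rho i j v :
  spectral_family A E th ->
  E i (td_expr A B beta gamma rho (E j v))
    = ((th i - th j) * td_poly beta gamma rho (th i) (th j))
        *: E i (B (E j v)).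
Proof.
case=> _ _ AE EA _; rewrite /td_expr /lfcomm.
rewrite !lfun_simp /= !(lfunD, lfunN, lfunZ, AE, EA, scalerDr).
set w := E i _; rewrite !(scalerA, =^~ scaleNr, =^~ scalerDl).
by congr (_ *: _); rewrite /td_poly; ring.
Qed.

Lemma td_expr_eq0 A B E th beta gamma rho :
    spectral_family A E th ->
    (forall i j, i != j -> td_poly beta gamma rho (th i) (th j) = 0
                           \/ forall v, E i (B (E j v)) = 0) ->
  td_expr A B beta gamma rho = 0.
Proof.
move=> spE zE; have [_ sumE _ _ _] := spE.
apply/lfunP => v; rewrite zero_lfunE -[LHS]sumE.
rewrite big1 // => i _; rewrite -(sumE v) !lfun_sum big1 // => j _.
rewrite (td_expr_block _ _ _ _ _ _ _ spE).
case: (eqVneq i j) => [->|ij]; first by rewrite subrr mul0r scale0r.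
by case: (zE i j ij) => [->|->]; rewrite ?mulr0 ?scale0r ?scaler0.
Qed.

(* With at most three eigenvalues, the factor td_poly only has to vanish at
   (th 0, th 1) and (th 1, th 2), which leaves beta free. *)
Lemma td_expr_beta0 A B E th :
    (d <= 2)%N -> spectral_family A E th ->
    (forall (i j : 'I_d.+1) v,
       ~~ ((i <= j.+1)%N && (j <= i.+1)%N) -> E i (B (E j v)) = 0) ->
  exists gamma rho, td_expr A B 0 gamma rho = 0.
Proof.
move=> d2 spE tri.
pose t k := th (inord k).
(* Subtracting the conditions at (t 0, t 1) and (t 1, t 2) gives t0² - t2² = γ (t0 - t2), hence this
   γ; either condition then determines ρ. *)
exists (t 0%N + t 2%N), (t 1%N ^+ 2 - t 0%N * t 1%N - t 0%N * t 2%N - t 1%N * t 2%N).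
apply: (td_expr_eq0 spE) => i j ij.
case: (boolP ((i <= j.+1)%N && (j <= i.+1)%N)) => [adj|/tri-E0]; last by right.
left; rewrite -[i]inord_val -[j]inord_val -!/(t _) /td_poly.
have : (i : nat) != j by [].
have := ltn_ord i; have := ltn_ord j.
case: (i : nat) (j : nat) adj => [|[|[|m]]] [|[|[|n]]] //= _; try lia;
  by move=> _ _ _; ring.
Qed.

(** If the block vanished, the sum [W] of the images of E_0, ..., E_k would contradict
    irreducibility: it contains the nonzero image of E_0, and the nonzero map E_{k+1} kills it. *)
Lemma td_block_neq0 A As E th :
    ~ (exists W, [/\ W != 0%VS, W != {:V}%VS,
                     (A @: W <= W)%VS & (As @: W <= W)%VS]) ->
    spectral_family As E th -> (forall i, E i != 0) ->
    (forall (i j : 'I_d.+1) v,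
       ~~ ((i <= j.+1)%N && (j <= i.+1)%N) -> E i (A (E j v)) = 0) ->
  forall k, (k < d)%N -> exists v, E (inord k.+1) (A (E (inord k) v)) != 0.
Proof.
move=> irr [_ sumE AE _ EE] nzE tri k kd.
have idx m : (m <= d)%N -> nat_of_ord (inord m : 'I_d.+1) = m.
  by move=> md; rewrite inordK.
pose X := E (inord k.+1) ** A ** E (inord k).
have XE v : X v = E (inord k.+1) (A (E (inord k) v)) by rewrite !lfun_simp.
case: (eqVneq X 0) => [X0|/lfunPn[v]]; last by rewrite XE zero_lfunE; exists v.
case: irr; pose W := (\sum_(j : 'I_d.+1 | (j <= k)%N) limg (E j))%VS.
have EW (j : 'I_d.+1) v : (j <= k)%N -> E j v \in W.
  by move=> jk; apply: (subvP (sumv_sup j jk (subvv _))); rewrite memv_img ?memvf.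
have stable (Y : 'End(V)) :
    (forall (j : 'I_d.+1) v, (j <= k)%N -> Y (E j v) \in W) -> (Y @: W <= W)%VS.
  move=> YW; rewrite limg_sum; apply/subv_sumP => j jk; apply/subvP => x.
  by case/memv_imgP => u /memv_imgP[v _ ->] ->; apply: YW.
exists W; split.
- have [v] := lfunPn (nzE ord0); rewrite zero_lfunE; apply: contraNneq => W0.
  by rewrite -memv0 -W0; apply: EW.
- have [v] := lfunPn (nzE (inord k.+1)); rewrite zero_lfunE; apply: contraNneq => WV.
  have : v \in W by rewrite WV memvf.
  case/memv_sumP => w wE ->; rewrite lfun_sum big1 // => j jk.
  have /memv_imgP[u _ ->] := wE j jk; rewrite EE.
  by case: eqP jk => // <-; rewrite idx // ltnn.
- apply: stable => j v jk; rewrite -[A _]sumE; apply: memv_suml => l _.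
  case: (leqP l k) => [lk|kl]; first exact: EW.
  case: (boolP ((l <= j.+1)%N && (j <= l.+1)%N)) => [adj|/tri->]; last exact: mem0v.
  (* Adjacency with j <= k < l leaves only this block as a way out of [W]. *)
  have -> : l = inord k.+1 by apply: val_inj; rewrite /= idx //; lia.
  have -> : j = inord k by apply: val_inj; rewrite /= idx //; lia.
  by rewrite -XE X0 zero_lfunE mem0v.
- by apply: stable => j v jk; rewrite AE memvZ // EW.
Qed.

(** The blocks (k+1, k) and (k+2, k+1) of [A] are nonzero and the eigenvalues are distinct, so
    [td_poly] vanishes at both pairs. The difference of the two values is (θ_{k+2} - θ_k)(θ_k - β
    θ_{k+1} + θ_{k+2} - γ). *)
Lemma td_recurrence A As E th beta gamma rho :
    ~ (exists W, [/\ W != 0%VS, W != {:V}%VS,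
                     (A @: W <= W)%VS & (As @: W <= W)%VS]) ->
    spectral_family As E th -> (forall i, E i != 0) ->
    (forall (i j : 'I_d.+1) v,
       ~~ ((i <= j.+1)%N && (j <= i.+1)%N) -> E i (A (E j v)) = 0) ->
    td_expr As A beta gamma rho = 0 ->
  forall k, (k.+2 <= d)%N ->
    th (inord k) - beta * th (inord k.+1) + th (inord k.+2) = gamma.
Proof.
move=> irr spE nzE tri rel.
have [inj_th _ _ _ _] := spE.
have th_neq k l : (k <= d)%N -> (l <= d)%N -> k != l ->
    th (inord k) - th (inord l) != 0.
  move=> kd ld; apply: contraNneq => /eqP; rewrite subr_eq0 => /eqP/inj_th.
  by move/(congr1 val); rewrite /= !inordK // => ->.
have pE k : (k < d)%N ->
    td_poly beta gamma rho (th (inord k.+1)) (th (inord k)) = 0.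
  move=> kd; have [v nz] := td_block_neq0 irr spE nzE tri kd.
  have /eqP := td_expr_block A beta gamma rho (inord k.+1) (inord k) v spE.
  rewrite rel zero_lfunE lfun0 eq_sym scaler_eq0 (negPf nz) orbF mulf_eq0.
  by rewrite (negPf (th_neq _ _ _ _ _)) ?(ltnW kd) //= => [/eqP|]; last lia.
move=> k kd; have p1 := pE k (ltnW kd); have p2 := pE k.+1 kd.
have nz : th (inord k.+2) - th (inord k) != 0 by apply: th_neq; lia.
apply/eqP; rewrite -subr_eq0 -(mulrI_eq0 _ (mulfI nz)); apply/eqP.
rewrite -[RHS](subrr 0) -{1}p2 -p1 /td_poly; ring.
Qed.

End Spectral.

(** * Grading of V by the eigenspaces of [As] *)

Section Grading.
Variables (K : fieldType) (V : vectType K) (d : nat).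
Variables (A As : 'End(V)) (E : 'I_d.+1 -> 'End(V)) (th0 : 'I_d.+1 -> K).
Variable th : int -> K.
Hypothesis spE : spectral_family As E th0.
Hypothesis tri : forall (i j : 'I_d.+1) v,
  ~~ ((i <= j.+1)%N && (j <= i.+1)%N) -> E i (A (E j v)) = 0.
Hypothesis thE : forall i : 'I_d.+1, th i = th0 i.

(** Degrees range over all integers, with zero projection outside 0, ..., d, so that words in the
    shifts need no boundary cases. *)
Definition gr_proj (k : int) : 'End(V) :=
  if k is Posz n then if (n <= d)%N then E (inord n) else 0 else 0.

Arguments gr_proj k : simpl never.

Definition homogeneous k v := gr_proj k v = v.

(** The degree [a] part of [A]; for a = -1, 0, 1 it is L, F, R. *)
Definition shift (a : int) : 'End(V) :=
  \sum_(i < d.+1) gr_proj (i%:Z + a) ** A ** E i.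

Definition steps : seq int := [:: -1; 0; 1].

Lemma gr_proj_ord (i : 'I_d.+1) : gr_proj i = E i.
Proof. by rewrite /gr_proj -ltnS ltn_ord inord_val. Qed.

Variant gr_proj_spec (k : int) : 'End(V) -> Prop :=
| GrProjOrd (i : 'I_d.+1) of k = i%:Z : gr_proj_spec k (E i)
| GrProjOut of (forall i : 'I_d.+1, k != i%:Z) : gr_proj_spec k 0.

Lemma gr_projP (k : int) : gr_proj_spec k (gr_proj k).
Proof.
rewrite /gr_proj; case: k => [n|n]; last by right.
case: leqP => nd; first by left; rewrite inordK.
by right=> i; apply/eqP => -[ni]; have := ltn_ord i; rewrite -ni ltnS leqNgt nd.
Qed.

Lemma gr_projK i j v : gr_proj i (gr_proj j v) = if i == j then gr_proj i v else 0.
Proof.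
have [_ _ _ _ EE] := spE.
case: (gr_projP j) => [m ->|jout].
  case: (gr_projP i) => [l ->|iout]; first by rewrite EE.
  by rewrite (negPf (iout m)) zero_lfunE.
rewrite zero_lfunE lfun0; case: eqP => [->|//].
by case: gr_projP => [m jm|_]; [move: (jout m); rewrite jm eqxx | rewrite zero_lfunE].
Qed.

Lemma homogeneous_proj k v : homogeneous k (gr_proj k v).
Proof. by rewrite /homogeneous gr_projK eqxx. Qed.

Lemma homogeneousP k v : homogeneous k v ->
  v = 0 \/ exists2 i : 'I_d.+1, k = i%:Z & v = E i v.
Proof.
rewrite /homogeneous; case: gr_projP => [i -> <-|_]; last by rewrite zero_lfunE; left.
right; exists i => //; have [_ _ _ _ EE] := spE.
by rewrite EE eqxx.
Qed.

Lemma homogeneous_eigen k v : homogeneous k v -> As v = th k *: v.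
Proof.
have [_ _ AE _ _] := spE.
case/homogeneousP => [->|[i -> ->]]; first by rewrite lfun0 scaler0.
by rewrite AE thE.
Qed.

Lemma shift_homogeneous k a v :
  homogeneous k v -> shift a v = gr_proj (k + a) (A v).
Proof.
have [_ _ _ _ EE] := spE.
case/homogeneousP => [->|[i -> vE]]; first by rewrite !lfun0.
rewrite /shift sum_lfunE (bigD1 i) //= !lfun_simp /= -vE.
rewrite big1 ?addr0 // => j ji; rewrite !lfun_simp /= vE EE (negPf ji).
by rewrite !lfun0.
Qed.

Lemma homogeneous_shift k a v : homogeneous k v -> homogeneous (k + a) (shift a v).
Proof. by move/shift_homogeneous->; apply: homogeneous_proj. Qed.

(** Compared component by component: the tridiagonal condition kills every component of [A v]
    outside the degrees k - 1, k, k + 1. *)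
Lemma sum_shift k v : homogeneous k v -> A v = \sum_(a <- steps) shift a v.
Proof.
move=> kv; have [_ sumE _ _ _] := spE.
rewrite -[LHS]sumE -[RHS]sumE; apply: eq_bigr => l _.
rewrite lfun_sum !big_cons big_nil !(shift_homogeneous _ kv) -gr_proj_ord !gr_projK.
case/homogeneousP: kv => [->|[i -> vE]]; first by rewrite !lfun0 !if_same !addr0.
case: (boolP ((l <= i.+1)%N && (i <= l.+1)%N)) => [adj|/tri].
  have : [\/ l%:Z = i%:Z - 1, l%:Z = i | l%:Z = i%:Z + 1].
    have : [|| l.+1 == i, (l : nat) == i | (l : nat) == i.+1] by lia.
    by case/or3P => /eqP; [constructor 1|constructor 2|constructor 3]; lia.
  set x := gr_proj _ _.
  by case=> lE; (do 3 case: eqP => ?; try lia); rewrite ?addr0 ?add0r.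
by rewrite -gr_proj_ord vE => ->; rewrite !if_same !addr0.
Qed.

Lemma gr_proj_homogeneous i k v :
  homogeneous k v -> gr_proj i v = if i == k then v else 0.
Proof.
by move=> kv; rewrite -{1}kv gr_projK; case: eqP => [->|//].
Qed.

(** * Homogeneous components of the first tridiagonal relation *)

Lemma sum_shiftZ k x v :
  homogeneous k v -> A (x *: v) = \sum_(a <- steps) x *: shift a v.
Proof. by move=> kv; rewrite lfunZ (sum_shift kv) scaler_sumr. Qed.

Lemma eigenZ k x v : homogeneous k v -> As (x *: v) = (x * th k) *: v.
Proof. by move=> kv; rewrite lfunZ (homogeneous_eigen kv) scalerA. Qed.

(** The cubic part of the relation is A³A* - (β+1) A²A*A + (β+1) AA*A² - A*A³. On the word that
    applies degrees c, b, a in turn to a vector of degree k, each A* reads off θ* at the degree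
    reached so far. *)
Definition cubic_coef (beta : K) k (c b a : int) : K :=
  th k - (beta + 1) * th (k + c) + (beta + 1) * th (k + (c + b))
  - th (k + (c + b + a)).

(** Each [A] is expanded into shifts and each [As] becomes a scalar on a homogeneous vector;
    projecting to degree k + e then selects the words of total degree e. The γ and ρ terms come from
    A²A* - A*A² and AA* - A*A. *)
Lemma td_component beta gamma rho k e v :
    td_expr A As beta gamma rho = 0 -> homogeneous k v ->
  \sum_(c <- steps) \sum_(b <- steps) \sum_(a <- steps)
     (if c + b + a == e
      then cubic_coef beta k c b a *: shift a (shift b (shift c v)) else 0)
  = gamma *: \sum_(c <- steps) \sum_(b <- steps)
       (if c + b == e then (th k - th (k + (c + b))) *: shift b (shift c v) else 0)
    + rho *: \sum_(c <- steps)
       (if c == e then (th k - th (k + c)) *: shift c v else 0).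
Proof.
move=> rel kv.
have h1 c : homogeneous (k + c) (shift c v) by apply: homogeneous_shift.
have h2 c b : homogeneous (k + (c + b)) (shift b (shift c v)).
  by rewrite addrA; apply: homogeneous_shift.
have h3 c b a : homogeneous (k + (c + b + a)) (shift a (shift b (shift c v))).
  by rewrite addrA; apply: homogeneous_shift.
have A0 : A v = \sum_(c <- steps) 1 *: shift c v.
  by rewrite -[v in LHS]scale1r; apply: sum_shiftZ kv.
have A1 x : A (x *: v) = \sum_(c <- steps) x *: shift c v by apply: sum_shiftZ kv.
have A2 (f : int -> K) : A (\sum_(c <- steps) f c *: shift c v)
    = \sum_(c <- steps) \sum_(b <- steps) f c *: shift b (shift c v).
  by rewrite lfun_sum; apply: eq_bigr => c _; apply: sum_shiftZ (h1 c).
have A3 (f : int -> int -> K) :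
    A (\sum_(c <- steps) \sum_(b <- steps) f c b *: shift b (shift c v))
    = \sum_(c <- steps) \sum_(b <- steps) \sum_(a <- steps)
        f c b *: shift a (shift b (shift c v)).
  rewrite lfun_sum; apply: eq_bigr => c _; rewrite lfun_sum.
  by apply: eq_bigr => b _; apply: sum_shiftZ (h2 c b).
have D0 : As v = th k *: v by apply: homogeneous_eigen kv.
have D1 (f : int -> K) : As (\sum_(c <- steps) f c *: shift c v)
    = \sum_(c <- steps) (f c * th (k + c)) *: shift c v.
  by rewrite lfun_sum; apply: eq_bigr => c _; apply: eigenZ (h1 c).
have D2 (f : int -> int -> K) :
    As (\sum_(c <- steps) \sum_(b <- steps) f c b *: shift b (shift c v))
    = \sum_(c <- steps) \sum_(b <- steps)
        (f c b * th (k + (c + b))) *: shift b (shift c v).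
  rewrite lfun_sum; apply: eq_bigr => c _; rewrite lfun_sum.
  by apply: eq_bigr => b _; apply: eigenZ (h2 c b).
have D3 (f : int -> int -> int -> K) :
    As (\sum_(c <- steps) \sum_(b <- steps) \sum_(a <- steps)
          f c b a *: shift a (shift b (shift c v)))
    = \sum_(c <- steps) \sum_(b <- steps) \sum_(a <- steps)
        (f c b a * th (k + (c + b + a))) *: shift a (shift b (shift c v)).
  rewrite lfun_sum; apply: eq_bigr => c _; rewrite lfun_sum.
  apply: eq_bigr => b _; rewrite lfun_sum.
  by apply: eq_bigr => a _; apply: eigenZ (h3 c b a).
pose t3 (f : int -> int -> int -> K) := \sum_(c <- steps) \sum_(b <- steps)
  \sum_(a <- steps) f c b a *: shift a (shift b (shift c v)).
pose t2 (f : int -> int -> K) := \sum_(c <- steps) \sum_(b <- steps)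
  f c b *: shift b (shift c v).
pose t1 (f : int -> K) := \sum_(c <- steps) f c *: shift c v.
have t3E : t3 (cubic_coef beta k)
    = t3 (fun _ _ _ => th k) - (beta + 1) *: t3 (fun c _ _ => th (k + c))
      + (beta + 1) *: t3 (fun c b _ => th (k + (c + b)))
      - t3 (fun c b a => th (k + (c + b + a))).
  rewrite /t3; do 3![rewrite !scaler_sumr -sumrB -big_split -sumrB /=;
    apply: eq_bigr => ? _].
  by rewrite !scalerA -scalerBl -scalerDl -scalerBl.
have t2E : t2 (fun c b => th k - th (k + (c + b)))
    = t2 (fun _ _ => th k) - t2 (fun c b => th (k + (c + b))).
  rewrite /t2; do 2![rewrite -sumrB /=; apply: eq_bigr => ? _].
  by rewrite -scalerBl.
have t1E : t1 (fun c => th k - th (k + c))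
    = t1 (fun _ => th k) - t1 (fun c => th (k + c)).
  by rewrite /t1 -sumrB /=; apply: eq_bigr => ? _; rewrite -scalerBl.
have relv : t3 (cubic_coef beta k) = gamma *: t2 (fun c b => th k - th (k + (c + b)))
    + rho *: t1 (fun c => th k - th (k + c)).
  have := congr1 (fun X : 'End(V) => X v) rel.
  rewrite zero_lfunE /td_expr /lfcomm !lfun_simp /=.
  rewrite !(lfunD, lfunN, lfunZ) !(A0, A1, A2, A3, D0, D1, D2, D3).
  have one1 (f : int -> K) : t1 (fun c => 1 * f c) = t1 f.
    by apply: eq_bigr => c _; rewrite mul1r.
  have one2 (f : int -> int -> K) : t2 (fun c b => 1 * f c b) = t2 f.
    by do 2![apply: eq_bigr => ? _]; rewrite mul1r.
  have one3 (f : int -> int -> int -> K) : t3 (fun c b a => 1 * f c b a) = t3 f.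
    by do 3![apply: eq_bigr => ? _]; rewrite mul1r.
  rewrite -/(t3 (fun _ _ _ => th k)) -/(t3 (fun c _ _ => 1 * th (k + c))).
  rewrite -/(t3 (fun c b _ => 1 * th (k + (c + b)))).
  rewrite -/(t3 (fun c b a => 1 * th (k + (c + b + a)))).
  rewrite -/(t2 (fun _ _ => th k)) -/(t2 (fun c _ => 1 * th (k + c))).
  rewrite -/(t2 (fun c b => 1 * th (k + (c + b)))).
  rewrite -/(t1 (fun _ => th k)) -/(t1 (fun c => 1 * th (k + c))).
  rewrite !one3 !one2 !one1 t3E t2E t1E => relv.
  apply/eqP; rewrite -subr_eq0 -relv !(scalerDl, scalerDr, scalerN, scale1r).
  rewrite !(opprD, opprK) !addrA; apply/eqP.
  (* Summands 5 and 10 are the two γ-multiples of A A* A, which the commutator produces with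
     opposite signs. *)
  by rewrite [RHS](ACl (1*2*7*8*3*9*4*11*6*12*(5*10))) /= addNr addr0.
have := congr1 (gr_proj (k + e)) relv.
rewrite lfunD !lfunZ /t3 /t2 /t1 !lfun_sum => relP.
have eqP k' x : homogeneous (k + k') x ->
    gr_proj (k + e) x = if k' == e then x else 0.
  move=> hx; rewrite (gr_proj_homogeneous _ hx).
  by rewrite (inj_eq (addrI k)) eq_sym.
transitivity (\sum_(c <- steps) gr_proj (k + e) (\sum_(b <- steps) \sum_(a <- steps)
  cubic_coef beta k c b a *: shift a (shift b (shift c v)))).
  apply: eq_bigr => c _; rewrite lfun_sum; apply: eq_bigr => b _.
  rewrite lfun_sum; apply: eq_bigr => a _; rewrite lfunZ (eqP _ _ (h3 c b a)).
  by case: ifP => // _; rewrite scaler0.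
rewrite relP; congr (_ *: _ + _ *: _); apply: eq_bigr => c _.
  rewrite lfun_sum; apply: eq_bigr => b _; rewrite lfunZ (eqP _ _ (h2 c b)).
  by case: ifP => // _; rewrite scaler0.
rewrite lfunZ (eqP _ _ (h1 c)).
by case: ifP => // _; rewrite scaler0.
Qed.

(** The degree tests compare closed integers and are decided by computation; the offsets inside [th]
    are reduced to literals so that equal degrees become syntactically equal. *)
Ltac expand_component :=
  rewrite /cubic_coef /steps !big_cons !big_nil;
  repeat match goal with |- context [if @eq_op int ?x ?y then _ else _] =>
    let b := eval vm_compute in (@eq_op int x y) in
    change (@eq_op int x y) with b; cbv iota end;
  repeat match goal with |- context [th (?k + ?x)] =>
    let y := eval vm_compute in x in progress change (th (k + x)) with (th (k + y)) end;
  rewrite ?add0r ?addr0.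

(** A three-letter word of degree 2s has one flat letter and two letters s. The word with the flat
    letter in the middle has coefficient θ*_k - θ*_{k+2s}, as does the γ term, so the identity is
    divided by it. The sign s treats lowering and raising together. *)
Lemma component_degree2 beta gamma rho s k k1 k2 v g1 g2 :
    s \in [:: -1; 1] -> td_expr A As beta gamma rho = 0 -> homogeneous k v ->
    k1 = k + s -> k2 = k + (s + s) -> th k - th k2 != 0 ->
    (th k - th k2) * g1 = th k - (beta + 1) * th k1 + beta * th k2 ->
    (th k - th k2) * g2 = - beta * th k + (beta + 1) * th k1 - th k2 ->
  g1 *: shift 0 (shift s (shift s v)) + shift s (shift 0 (shift s v))
    + g2 *: shift s (shift s (shift 0 v))
  = gamma *: shift s (shift s v).
Proof.
move=> s1 rel kv -> ->.
have comp := td_component (s + s) rel kv.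
move=> nzD g1E g2E; apply: (scalerI nzD).
rewrite !(scalerDr, scalerA) [_ * gamma]mulrC -[in RHS]scalerA g1E g2E.
move: s1 comp {nzD g1E g2E}; rewrite !inE => /orP[] /eqP ->.
all: expand_component; rewrite scaler0 addr0 => <-.
- by congr (_ *: _ + _ *: _ + _ *: _); ring.
- rewrite [RHS](AC (1*2) (3*2*1)).
  by congr (_ *: _ + _ *: _ + _ *: _); ring.
Qed.

(** The identity is divided by θ*_k - θ*_{k+s}. The conditions on [e1] and [e2] are equations
    between vectors, not scalars, so that they hold for arbitrary coefficients when the word
    vanishes; this accommodates the indeterminates. *)
Lemma component_degree1 beta gamma rho s s' k km k1 k2 v e1 e2 :
    s \in [:: -1; 1] -> td_expr A As beta gamma rho = 0 -> homogeneous k v ->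
    s' = - s -> km = k - s -> k1 = k + s -> k2 = k + (s + s) -> th k - th k1 != 0 ->
    ((th k - th k1) * e1) *: shift s' (shift s (shift s v))
      = (th k - (beta + 1) * th k1 + (beta + 1) * th k2 - th k1)
          *: shift s' (shift s (shift s v)) ->
    ((th k - th k1) * e2) *: shift s (shift s (shift s' v))
      = (th k - (beta + 1) * th km + (beta + 1) * th k - th k1)
          *: shift s (shift s (shift s' v)) ->
  e1 *: shift s' (shift s (shift s v))
    + (beta + 2) *: shift s (shift s' (shift s v))
    + e2 *: shift s (shift s (shift s' v))
    + shift s (shift 0 (shift 0 v)) - beta *: shift 0 (shift s (shift 0 v))
    + shift 0 (shift 0 (shift s v))
  = gamma *: (shift s (shift 0 v) + shift 0 (shift s v)) + rho *: shift s v.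
Proof.
move=> s1 rel kv -> -> -> ->.
have comp := td_component s rel kv.
move=> nzD e1E e2E; apply: (scalerI nzD).
rewrite !(scalerDr, scalerN, scalerA) e1E e2E.
move: s1 comp {nzD e1E e2E}; rewrite !inE => /orP[] /eqP ->.
all: expand_component; rewrite ?opprK -scaleNr !(scalerDr, scalerA) => comp.
- apply: etrans (etrans comp _).
    rewrite [RHS](AC (1*2*3) (1*3*6*5*4*2)).
    by congr (_ *: _ + _ *: _ + _ *: _ + _ *: _ + _ *: _ + _ *: _); ring.
  rewrite [RHS](ACl (2*1*3)).
  by congr (_ *: _ + _ *: _ + _ *: _); ring.
- apply: etrans (etrans comp _).
    rewrite [RHS](AC (1*(2*(1*2))) (6*4*1*2*3*5)).
    by congr (_ *: _ + _ *: _ + _ *: _ + _ *: _ + _ *: _ + _ *: _); ring.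
  by congr (_ *: _ + _ *: _ + _ *: _); ring.
Qed.

(** In degree 0 the outer terms θ*_k cancel, so a word has coefficient β + 1 times θ*_{k+c+b} -
    θ*_{k+c}. This is zero when b = 0, which removes FFF, LFR and RFL; the γ and ρ terms vanish too.
    Four words remain. *)
Lemma component_degree0 beta gamma rho k v :
    td_expr A As beta gamma rho = 0 -> homogeneous k v -> beta + 1 != 0 ->
  (th k - th (k + 1)) *:
    (shift 0 (shift (-1) (shift 1 v)) - shift (-1) (shift 1 (shift 0 v)))
  = (th (k - 1) - th k) *:
    (shift 0 (shift 1 (shift (-1) v)) - shift 1 (shift (-1) (shift 0 v))).
Proof.
move=> rel kv nz; have := td_component 0 rel kv.
expand_component.
have cancel (x y : K) : x - y + y - x = 0 by ring.
have factor (x y z : K) : x - (beta + 1) * y + (beta + 1) * z - x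
  = (beta + 1) * (z - y) by ring.
rewrite !cancel !factor subrr !(scale0r, scaler0, addr0, add0r).
rewrite -!scalerA -!scalerDr => /eqP; rewrite scaler_eq0 (negPf nz) /= => /eqP comp.
apply/eqP; rewrite -subr_eq0 -comp !scalerBr opprD opprK -!scaleNr !opprB.
by rewrite [X in _ == X](AC (1*3) ((4*3)*(1*2))).
Qed.

(** * The shifts as raising, flat and lowering maps *)

Lemma gr_proj_out (k : int) : (k < 0) || (d%:Z < k) -> gr_proj k = 0.
Proof. by case: gr_projP => // i ->; have := ltn_ord i; lia. Qed.

Lemma shift1E : shift 1 = raising A E.
Proof.
rewrite /shift /raising big_ord_recr /= big_mkord.
rewrite (@gr_proj_out (d%:Z + 1)); last by lia.
rewrite !comp_lfun0l addr0; apply: eq_bigr => i _.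
have -> : i%:Z + 1 = (inord i.+1 : 'I_d.+1) by rewrite inordK ?ltnS //; lia.
rewrite gr_proj_ord; congr (_ ** E _).
by apply: val_inj; rewrite /= inordK // ltnS ltnW.
Qed.

Lemma shift0E : shift 0 = flat A E.
Proof.
rewrite /shift /flat big_mkord; apply: eq_bigr => i _.
by rewrite addr0 gr_proj_ord inord_val.
Qed.

Lemma shiftN1E : shift (-1) = lowering A E.
Proof.
rewrite /shift /lowering big_ord_recl /= big_add1 /= big_mkord.
rewrite gr_proj_out //.
rewrite !comp_lfun0l add0r; apply: eq_bigr => i _.
have -> : (lift ord0 i)%:Z - 1 = (inord i : 'I_d.+1).
  by rewrite inordK ?ltnS ?(ltnW (ltn_ord i)) //= /bump; lia.
rewrite gr_proj_ord; congr (_ ** E _).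
by apply: val_inj; rewrite /= inordK // ltnS ltn_ord.
Qed.

Lemma homogeneous_out k v : homogeneous k v -> (k < 0) || (d%:Z < k) -> v = 0.
Proof.
by case/homogeneousP => [->//|[i -> _]]; have := ltn_ord i; lia.
Qed.

Lemma homogeneous_limg (i : nat) v :
  (i <= d)%N -> v \in limg (E (inord i)) -> homogeneous i v.
Proof.
move=> id /memv_imgP[w _ ->]; have [_ _ _ _ EE] := spE.
by rewrite /homogeneous /gr_proj id EE eqxx.
Qed.

End Grading.

(** * The recurrence for the extended dual eigenvalues *)

Lemma sub_eq_transfer (U : zmodType) (x y p q : U) :
  p = q -> x - y = p - q -> x = y.
Proof. by move=> ->; rewrite subrr => /eqP; rewrite subr_eq0 => /eqP. Qed.

(** The cases b = 0 and b = d hold by the choice of the extended scalars; the others are the given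
    recurrence. The indices are variables tied by equations so that they can be supplied in any
    syntactic form. *)
Lemma extend_dual_eigenvalues_rec (K : fieldType) (d : nat)
    (ths : 'I_d.+1 -> K) (beta gammas : K)
    (th := extend_dual_eigenvalues ths beta gammas) :
    (1 <= d)%N ->
    (forall k, (k.+2 <= d)%N ->
       ths (inord k) - beta * ths (inord k.+1) + ths (inord k.+2) = gammas) ->
  forall a b c : int, a = b - 1 -> c = b + 1 -> 0 <= b <= d%:Z ->
    th a - beta * th b + th c = gammas.
Proof.
move=> d1 rec a b c -> ->; case: b => // n nd; have {}nd : (n <= d)%N by lia.
have thE m : (m <= d)%N -> th m = ths (inord m) by rewrite /th /= => ->.
have up : th d.+1 = gammas + beta * ths (inord d) - ths (inord d.-1).
  by rewrite /th /= ltnn.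
have -> : n%:Z + 1 = n.+1 by lia.
case: n nd => [|n] nd.
  by rewrite [th (_ - _)]/(th (-1)) !thE // /th /=; ring.
have -> : n.+1%:Z - 1 = n by lia.
case: (ltngtP n.+1 d) nd => [nd|//|nd] _.
  by rewrite !thE ?rec //; lia.
have dn : d.-1 = n by lia.
by rewrite (thE n) ?(thE n.+1) ?nd // ?up ?dn /=; [ring|lia].
Qed.

(** * Matching the coefficients of the components with g, e and θ* *)

Theorem theorem5p1 (K : fieldType) (V : vectType K) (d : nat)
    (A As : 'End(V)) (E Es : 'I_d.+1 -> 'End(V)) (ths : 'I_d.+1 -> K)
    (beta gamma gammas rho rhos : K) :
  (0 < \dim {:V})%N ->
  (1 <= d)%N ->
  td_system A E As Es ->
  eigenvalue_sequence As Es ths ->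
  tridiagonal_relations A As beta gamma gammas rho rhos ->
  let th := extend_dual_eigenvalues ths beta gammas in
  let R := raising A Es in
  let F := flat A Es in
  let L := lowering A Es in
  [/\ forall i : nat, (2 <= i <= d)%N ->
        {in limg (Es (inord i)),
           g_minus th i *: (F ** L ** L) + L ** F ** L
             + g_plus th i *: (L ** L ** F)
           =1 gamma *: (L ** L)} /\
        {in limg (Es (inord (i - 2))),
           g_minus th i *: (R ** R ** F) + R ** F ** R
             + g_plus th i *: (F ** R ** R)
           =1 gamma *: (R ** R)},
      forall (x y : K) (i : nat), (1 <= i <= d)%N ->
        {in limg (Es (inord i)),
           e_minus th y i *: (R ** L ** L) + (beta + 2) *: (L ** R ** L)
             + e_plus d th x i *: (L ** L ** R)
             + L ** F ** F - beta *: (F ** L ** F) + F ** F ** L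
           =1 gamma *: (L ** F + F ** L) + rho *: L} /\
        {in limg (Es (inord (i - 1))),
           e_minus th y i *: (R ** R ** L) + (beta + 2) *: (R ** L ** R)
             + e_plus d th x i *: (L ** R ** R)
             + F ** F ** R - beta *: (F ** R ** F) + R ** F ** F
           =1 gamma *: (F ** R + R ** F) + rho *: R}
    & forall i : nat, (0 <= i <= d)%N ->
        {in limg (Es (inord i)),
           (th i - th (i%:Z + 1)) *: lfcomm F (L ** R)
           =1 (th (i%:Z - 1) - th i) *: lfcomm F (R ** L)}].
Proof.
move=> _ d1 [[[diagA diagAs] _ _ irr] stA stAs] eigs [/esym rel /esym rels] th R F L.
have [thA [spA _ triA]] := standard_idempotents_spectral diagA stA.
have [th0 [spE0 limE tri]] := standard_idempotents_spectral diagAs stAs.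
have th0E i : th0 i = ths i.
  have [nz eqU] := limE i; have [_ eqU'] := eigs i.
  by apply: (leigenspace_inj nz); rewrite -eqU -eqU'.
have spE : spectral_family As Es ths.
  have [inj sumE AE EA EE] := spE0; split=> //.
  - by move=> i j; rewrite -!th0E => /inj.
  - by move=> i v; rewrite AE th0E.
  - by move=> i v; rewrite EA th0E.
have nzE i : Es i != 0.
  have [nz eqU] := limE i; apply: contraNneq nz => Ei0.
  by rewrite -eqU Ei0 lim0g.
have rec := extend_dual_eigenvalues_rec d1 (td_recurrence irr spE nzE tri rels).
(* Equating the recurrence at b - 1 and at b eliminates [gammas]. *)
have {}rec (b : int) : 0 <= b - 1 -> b <= d%:Z ->
    forall a c d' : int, a = b - 2 -> c = b - 1 ->
    d' = b + 1 -> th a - beta * th c + th b = th c - beta * th b + th d'.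
  by move=> b1 bd a c d' -> -> ->; rewrite !rec //; lia.
have thE (i : 'I_d.+1) : th i = ths i.
  by rewrite /th /= -ltnS ltn_ord inord_val.
have th_neq (k l : int) : 0 <= k <= d%:Z -> 0 <= l <= d%:Z -> k != l -> th k - th l != 0.
  case: k => // k; case: l => // l kd ld.
  have {}kd : (k <= d)%N by lia.
  have {}ld : (l <= d)%N by lia.
  have [inj_th _ _ _ _] := spE.
  rewrite /th /= kd ld subr_eq0; apply: contra => /eqP/inj_th.
  by move/(congr1 val); rewrite /= !inordK // => ->.
have RE : R = shift A Es 1 by rewrite shift1E.
have FE : F = shift A Es 0 by rewrite shift0E.
have LE : L = shift A Es (-1) by rewrite shiftN1E.
have hom := homogeneous_limg spE.
have out := homogeneous_out spE.
have step := homogeneous_shift A spE.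
split.
- move=> i /andP[i2 id]; rewrite RE FE LE.
  have nzD : th i - th (i%:Z - 2) != 0 by apply: th_neq; lia.
  have nzD' : th (i%:Z - 2) - th i != 0 by rewrite -opprB oppr_eq0.
  have gpE : (th i - th (i%:Z - 2)) * g_plus th i = th i - th (i%:Z + 1).
    by rewrite mulrC divfK.
  have gmE : (th (i%:Z - 2) - th i) * g_minus th i = th (i%:Z - 2) - th (i%:Z - 3).
    by rewrite mulrC divfK.
  have id' : i%:Z <= d%:Z by lia.
  split=> v vin; rewrite !(comp_lfunE, add_lfunE, opp_lfunE, scale_lfunE).
  + apply: (component_degree2 spE tri thE _ rel (hom _ _ id vin) (s := -1)
      (k1 := i%:Z - 1) (k2 := i%:Z - 2)) => //.
    * rewrite -opprB mulNr gmE.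
      apply: (sub_eq_transfer
        (rec (i%:Z - 1) _ _ (i%:Z - 3) (i%:Z - 2) i%:Z _ _ _)); try lia.
      ring.
    * rewrite gpE.
      apply: (sub_eq_transfer
        (rec i%:Z _ _ (i%:Z - 2) (i%:Z - 1) (i%:Z + 1) _ _ _)); try lia.
      ring.
  + have {}vin : homogeneous Es (i%:Z - 2) v.
      have -> : i%:Z - 2 = (i - 2)%N by lia.
      by apply: hom vin; lia.
    (* Raising lists the words in the opposite order, so [g_plus] now plays the part of [g1]. *)
    rewrite [LHS](ACl (3*2*1)).
    apply: (component_degree2 spE tri thE _ rel vin (s := 1)
      (k1 := i%:Z - 1) (k2 := i)) => //; try lia.
    * rewrite -opprB mulNr gpE.
      apply: (sub_eq_transfer
        (esym (rec i%:Z _ _ (i%:Z - 2) (i%:Z - 1) (i%:Z + 1) _ _ _))); try lia.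
      ring.
    * rewrite gmE.
      apply: (sub_eq_transfer
        (esym (rec (i%:Z - 1) _ _ (i%:Z - 3) (i%:Z - 2) i%:Z _ _ _))); try lia.
      ring.
- move=> x y i /andP[i1 id]; rewrite RE FE LE.
  have nzD : th i - th (i%:Z - 1) != 0 by apply: th_neq; lia.
  have nzD' : th (i%:Z - 1) - th i != 0 by rewrite -opprB oppr_eq0.
  have epE : i != d -> (th i - th (i%:Z - 1)) * e_plus d th x i = th i - th (i%:Z + 2).
    by move=> ni; rewrite /e_plus ifN // mulrC divfK.
  have emE : i != 1%N ->
      (th (i%:Z - 1) - th i) * e_minus th y i = th (i%:Z - 1) - th (i%:Z - 3).
    by move=> ni; rewrite /e_minus ifN // mulrC divfK.
  split=> v vin; rewrite !(comp_lfunE, add_lfunE, opp_lfunE, scale_lfunE).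
  + have {}vin := hom _ _ id vin.
    apply: (component_degree1 spE tri thE _ rel vin (s := -1) (s' := 1)
      (km := i%:Z + 1) (k1 := i%:Z - 1) (k2 := i%:Z - 2)) => //.
    (* For i = 1 the vector L²v has degree -1 and is zero, so y is arbitrary; likewise Rv = 0 for i
       = d below. *)
    * case: (eqVneq i 1%N) => [i0|ni].
        rewrite (out _ (shift A Es (-1) (shift A Es (-1) v)) (step _ _ _ (step _ _ _ vin))).
          by rewrite lfun0 !scaler0.
        lia.
      rewrite -opprB mulNr emE //; congr (_ *: _).
      apply: (sub_eq_transfer
        (rec (i%:Z - 1) _ _ (i%:Z - 3) (i%:Z - 2) i%:Z _ _ _)); try lia.
      ring.
    * case: (eqVneq i d) => [i0|ni].
        rewrite (out _ (shift A Es 1 v) (step _ _ _ vin)); last by lia.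
        by rewrite !lfun0 !scaler0.
      rewrite epE //; congr (_ *: _).
      apply: (sub_eq_transfer
        (rec (i%:Z + 1) _ _ (i%:Z - 1) i%:Z (i%:Z + 2) _ _ _)); try lia.
      ring.
  + have {}vin : homogeneous Es (i%:Z - 1) v.
      have -> : i%:Z - 1 = (i - 1)%N by lia.
      by apply: hom vin; lia.
    rewrite [LHS](ACl (3*2*1*6*5*4)) [_ + shift A Es 1 (shift A Es 0 v)]addrC.
    apply: (component_degree1 spE tri thE _ rel vin (s := 1) (s' := -1)
      (km := i%:Z - 2) (k1 := i%:Z) (k2 := i%:Z + 1)) => //; try lia.
    * case: (eqVneq i d) => [i0|ni].
        rewrite (out _ (shift A Es 1 (shift A Es 1 v)) (step _ _ _ (step _ _ _ vin))).
          by rewrite lfun0 !scaler0.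
        lia.
      rewrite -opprB mulNr epE //; congr (_ *: _).
      apply: (sub_eq_transfer
        (esym (rec (i%:Z + 1) _ _ (i%:Z - 1) i%:Z (i%:Z + 2) _ _ _))); try lia.
      ring.
    * case: (eqVneq i 1%N) => [i0|ni].
        rewrite (out _ (shift A Es (-1) v) (step _ _ _ vin)); last by lia.
        by rewrite !lfun0 !scaler0.
      rewrite emE //; congr (_ *: _).
      apply: (sub_eq_transfer
        (esym (rec (i%:Z - 1) _ _ (i%:Z - 3) (i%:Z - 2) i%:Z _ _ _))); try lia.
      ring.
(* [th] stays extended by the original β: the grading constrains it only on 0, ..., d, so it may be
   combined with a relation for another β'. *)
have [beta' [gamma' [rho' [nzb rel']]]] : exists beta' gamma' rho',
    beta' + 1 != 0 /\ td_expr A As beta' gamma' rho' = 0.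
  case: (eqVneq (beta + 1) 0) => [b0|nzb]; last by exists beta, gamma, rho.
  case: (leqP d 2) => [d2|d3].
    have [gamma' [rho' rel']] := td_expr_beta0 d2 spA triA.
    by exists 0, gamma', rho'; rewrite add0r oner_neq0.
  have bE : beta = -1 by apply/eqP; rewrite -subr_eq0 opprK b0.
  have /eqP[] : th 0 - th 3 != 0 by apply: th_neq; lia.
  have d2 : 2 <= d%:Z by lia.
  have := rec 2 isT d2 0 1 3 erefl erefl erefl; rewrite bE => r.
  have eq03 : th 0 = th 3 by apply: (sub_eq_transfer r); ring.
  by rewrite eq03 subrr.
move=> i id v vin; rewrite RE FE LE /lfcomm.
rewrite !(comp_lfunE, add_lfunE, opp_lfunE, scale_lfunE).
exact: (component_degree0 spE tri thE rel' (hom _ _ id vin) nzb).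
Qed.
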